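(* Let $D$ be an integral domain (a commutative $\Bbbk$-algebra), let $R=D(\sigma,a)$ be a generalized Weyl algebra, and let $\mu\in\Bbbk^\times$ have finite multiplicative order $m=\mathrm{ord}(\mu)<\infty$. Suppose that $\phi\in\mathrm{Aut}(R)$ satisfies: (1) $\phi|_D$ is an automorphism of $D$ with $n=\mathrm{ord}(\phi|_D)<\infty$; (2) $\phi(x)=\mu^{-1}x$ and $\phi(y)=\mu y$. If $\gcd(m,n)=1$, then the fixed ring is the generalized Weyl algebra $$R^{\langle\phi\rangle}=D^{\langle\phi\rangle}(\sigma^m,A),\qquad A=\prod_{i=0}^{m-1}\sigma^{-i}(a),$$ where the canonical generators of this generalized Weyl algebra over $D^{\langle\phi\rangle}$ are $X=x^m$ and $Y=y^m$.
   Context: $\Bbbk$ is a field and all algebras are associative $\Bbbk$-algebras; automorphisms are $\Bbbk$-algebra automorphisms. For a commutative algebra $D$, $\sigma\in\mathrm{Aut}(D)$ and $0\neq a\in D$, the (degree one) generalized Weyl algebra (GWA) $D(\sigma,a)$ is the algebra generated over $D$ by $x$ and $y$ subject to the relations $xd=\sigma(d)x$, $yd=\sigma^{-1}(d)y$ for all $d\in D$, $yx=a$, $xy=\sigma(a)$. For an automorphism $\phi$ of $R$, $R^{\langle\phi\rangle}$ is the subring of elements fixed by $\phi$, and $D^{\langle\phi\rangle}=D\cap R^{\langle\phi\rangle}$. *)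

(* Defs.v *)
From HB Require Import structures.
From mathcomp Require Import all_boot all_order all_algebra.
Set Implicit Arguments.
Unset Strict Implicit.
Unset Printing Implicit Defensive.
Import GRing.Theory.
Local Open Scope ring_scope.

Record algAut (k : fieldType) (A : algType k) := AlgAut {
  aut_fun :> {lrmorphism A -> A};
  aut_inv : A -> A;
  aut_funK : cancel aut_fun aut_inv;
  aut_invK : cancel aut_inv aut_fun
}.

Definition has_order (T : Type) (f : T -> T) (n : nat) : Prop :=
  [/\ (0 < n)%N, iter n f =1 id &
      forall j, (0 < j < n)%N -> ~ (iter j f =1 id)].

Definition gwa_rel (k : fieldType) (D : comAlgType k) (sigma : algAut D) (a : D)
    (S : algType k) (f : D -> S) (u v : S) : Prop :=
  [/\ forall d, u * f d = f (sigma d) * u,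
      forall d, v * f d = f (aut_inv sigma d) * v,
      v * u = f a &
      u * v = f (sigma a)].

(* [is_gwa sigma a iota x y]: the algebra R, with structure map iota : D -> R
   and canonical generators x and y, is D(sigma, a).  "Generated over D by x
   and y subject to the relations" is expressed by the universal property of a
   presentation: R carries a solution of the relations, and every other
   solution S is the image of it under exactly one algebra morphism.
   Restricting S to nontrivial algebras (which algType imposes) is harmless,
   since there is always exactly one morphism to the zero algebra. *)
Definition is_gwa (k : fieldType) (D : comAlgType k) (sigma : algAut D) (a : D)
    (R : algType k) (iota : {lrmorphism D -> R}) (x y : R) : Prop :=
  [/\ a != 0,
      gwa_rel sigma a iota x y &
      forall (S : algType k) (f : {lrmorphism D -> S}) (u v : S),
        gwa_rel sigma a f u v ->
        (exists g : {lrmorphism R -> S},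
           [/\ forall d, g (iota d) = f d, g x = u & g y = v]) /\
        (forall g h : {lrmorphism R -> S},
           [/\ forall d, g (iota d) = f d, g x = u & g y = v] ->
           [/\ forall d, h (iota d) = f d, h x = u & h y = v] ->
           g =1 h)].

Section FixedRing.
Variables (k : fieldType) (R : algType k) (phi : algAut R).

Definition fixed_pred : pred R := fun r => phi r == r.

Fact fixed_pred_closed : subalg_closed fixed_pred.
Proof.
split=> [|c u v /eqP Hu /eqP Hv|u v /eqP Hu /eqP Hv]; apply/eqP.
- exact: rmorph1.
- by rewrite linearP /= Hu Hv.
- by rewrite rmorphM /= Hu Hv.
Qed.

HB.instance Definition _ :=
  GRing.isSubalgClosed.Build k R fixed_pred fixed_pred_closed.

Record fixed_ring := FixedRing { fixed_val : R; _ : fixed_val \in fixed_pred }.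

HB.instance Definition _ := [isSub for fixed_val].
HB.instance Definition _ := [Choice of fixed_ring by <:].
HB.instance Definition _ := [SubChoice_isSubAlgebra of fixed_ring by <:].

End FixedRing.

(* D :&: R^<phi>, for D mapped to R by iota. *)
Section FixedBase.
Variables (k : fieldType) (D : comAlgType k) (R : algType k).
Variables (iota : {lrmorphism D -> R}) (phi : algAut R).

Definition fixed_base_pred : pred D := fun d => iota d \in fixed_pred phi.

Fact fixed_base_pred_closed : subalg_closed fixed_base_pred.
Proof.
have [c1 cL cM] := fixed_pred_closed phi.
split=> [|c u v Hu Hv|u v Hu Hv]; rewrite unfold_in /fixed_base_pred.
- by rewrite rmorph1.
- by rewrite linearP; apply: cL.
- by rewrite rmorphM; apply: cM.
Qed.

HB.instance Definition _ :=
  GRing.isSubalgClosed.Build k D fixed_base_pred fixed_base_pred_closed.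

Record fixed_base :=
  FixedBase { fixed_base_val : D; _ : fixed_base_val \in fixed_base_pred }.

HB.instance Definition _ := [isSub for fixed_base_val].
HB.instance Definition _ := [Choice of fixed_base by <:].
HB.instance Definition _ := [SubChoice_isSubAlgebra of fixed_base by <:].
HB.instance Definition _ :=
  GRing.SubNzRing_isSubComNzRing.Build D fixed_base_pred fixed_base.

Definition fixed_incl (d : fixed_base) : fixed_ring phi :=
  FixedRing (valP d : iota (val d) \in fixed_pred phi).

Fact fixed_incl_is_linear : linear fixed_incl.
Proof. by move=> c u v; apply: val_inj; rewrite /= !linearP. Qed.

Fact fixed_incl_is_monoid_morphism : monoid_morphism fixed_incl.
Proof.
by split=> [|u v]; apply: val_inj; rewrite /= ?rmorph1 ?rmorphM.
Qed.

HB.instance Definition _ :=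
  GRing.isLinear.Build k fixed_base (fixed_ring phi) _ fixed_incl
    fixed_incl_is_linear.
HB.instance Definition _ :=
  GRing.isMonoidMorphism.Build fixed_base (fixed_ring phi) fixed_incl
    fixed_incl_is_monoid_morphism.

End FixedBase.

Arguments fixed_incl {k D R} iota phi d.

(* Main.v *)
(* The words ..., y^2, y, 1, x, x^2, ... form a basis of R over D: they span
   because their span is stable under left multiplication by D, x and y, and
   they are independent because the left regular action can be written down
   on coefficient families int -> D.  Conversely, such a basis together with
   the relations implies the universal property.  The automorphism phi scales
   the word of degree i by mu^-i, so the coefficient d of degree i of a fixed
   element satisfies phi(d) = mu^i d; iterating n times gives d = 0 or m | i n,
   hence m | i, and then d is itself fixed.  The words of degree divisible by m
   are the words in x^m and y^m, which therefore form a basis of the fixed ring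
   over the fixed subring of D. *)
Require Import Defs.
From HB Require Import structures.
From mathcomp Require Import all_boot all_order all_algebra.
From mathcomp Require Import boolp functions zify.
Set Implicit Arguments.
Unset Strict Implicit.
Unset Printing Implicit Defensive.
Import GRing.Theory.
Local Open Scope ring_scope.

(** * Induction along the generators of a generalized Weyl algebra *)

Section SubalgebraInduction.
Variables (k : fieldType) (R : algType k) (P : R -> Prop).
Hypotheses (P1 : P 1) (PL : forall c u v, P u -> P v -> P (c *: u + v))
  (PM : forall u v, P u -> P v -> P (u * v)).

(** Made boolean by [asbool], [P] cuts out a subalgebra type, which is then an admissible target in
    the universal property. *)
Definition subalg_pred : pred R := fun r => `[< P r >].

Fact subalg_pred_closed : subalg_closed subalg_pred.
Proof.
split=> [|c u v /asboolP Hu /asboolP Hv|u v /asboolP Hu /asboolP Hv];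
  apply/asboolP; [exact: P1 | exact: PL | exact: PM].
Qed.

HB.instance Definition _ :=
  GRing.isSubalgClosed.Build k R subalg_pred subalg_pred_closed.

Record subalg := Subalg { subalg_val : R; _ : subalg_val \in subalg_pred }.

HB.instance Definition _ := [isSub for subalg_val].
HB.instance Definition _ := [Choice of subalg by <:].
HB.instance Definition _ := [SubChoice_isSubAlgebra of subalg by <:].

Let proj (s : subalg) : R := val s.
Fact subalg_proj_is_linear : linear proj. Proof. by []. Qed.
Fact subalg_proj_is_monoid_morphism : monoid_morphism proj. Proof. by []. Qed.

HB.instance Definition _ :=
  GRing.isLinear.Build k subalg R _ proj subalg_proj_is_linear.
HB.instance Definition _ :=
  GRing.isMonoidMorphism.Build subalg R proj subalg_proj_is_monoid_morphism.

Variables (D : comAlgType k) (sigma : algAut D) (a : D).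
Variables (iota : {lrmorphism D -> R}) (x y : R).
Hypotheses (R_gwa : is_gwa sigma a iota x y).
Hypotheses (PD : forall d, P (iota d)) (Px : P x) (Py : P y).

Let inP r (H : P r) : r \in subalg_pred := asboolT H.

Let incl (d : D) : subalg := Subalg (inP (PD d)).

Fact subalg_incl_is_linear : linear incl.
Proof. by move=> c u v; apply: val_inj; rewrite /= linearP. Qed.

Fact subalg_incl_is_monoid_morphism : monoid_morphism incl.
Proof. by split=> [|u v]; apply: val_inj; rewrite /= ?rmorph1 ?rmorphM. Qed.

HB.instance Definition _ :=
  GRing.isLinear.Build k D subalg _ incl subalg_incl_is_linear.
HB.instance Definition _ :=
  GRing.isMonoidMorphism.Build D subalg incl subalg_incl_is_monoid_morphism.

(** The universal property maps [R] into the subalgebra cut out by [P]. Followed by the inclusion,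
    this map fixes [iota d], [x] and [y], so by uniqueness it is the identity. *)
Lemma gwa_ind r : P r.
Proof.
have [_ [xd yd yx xy] univ] := R_gwa.
have [|[g [gD gx gy]] _] :=
  univ subalg incl (Subalg (inP Px)) (Subalg (inP Py)).
  by split=> *; apply: val_inj; rewrite /= ?xd ?yd ?yx ?xy.
have [_ uniq_gwa] := univ R iota x y (And4 xd yd yx xy).
pose h : {lrmorphism R -> R} := proj \o g.
have -> : r = val (g r).
  apply: (uniq_gwa idfun h) => //.
  by split=> [d||]; rewrite /h /= ?gD ?gx ?gy.
by apply/asboolP; exact: (valP (g r)).
Qed.

End SubalgebraInduction.

(** * The algebra of linear operators on coefficient families *)

Section LinearOperators.
Variables (k : fieldType) (D : comAlgType k).
Local Notation V := (int -> D).

(** Linearity is over [k] only: left multiplication by [x] twists coefficients by [sigma] and so is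
    not [D]-linear. Families of infinite support are harmless, since only the orbit of one family
    will matter. *)
Definition linop_pred : pred (V -> V) := fun f => `[< linear f >].

Fact linop_pred_closed : submod_closed linop_pred.
Proof.
split=> [|c f g /asboolP Lf /asboolP Lg]; apply/asboolP=> b u v.
  by change (0 = b *: 0 + 0 :> V); rewrite scaler0 addr0.
change (c *: f (b *: u + v) + g (b *: u + v)
  = b *: (c *: f u + g u) + (c *: f v + g v)).
by rewrite Lf Lg !scalerDr !scalerA addrACA mulrC.
Qed.

HB.instance Definition _ :=
  GRing.isSubmodClosed.Build k (V -> V) linop_pred linop_pred_closed.

Record linop := Linop { linop_fun :> V -> V; _ : linop_fun \in linop_pred }.

HB.instance Definition _ := [isSub for linop_fun].
HB.instance Definition _ := [Choice of linop by <:].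
HB.instance Definition _ := [SubChoice_isSubLmodule of linop by <:].

Definition mk_linop (f : V -> V) (Lf : linear f) : linop :=
  Linop (asboolT Lf : f \in linop_pred).

Lemma linopP (f : linop) : linear f.
Proof. by apply/asboolP; exact: (valP f). Qed.

Lemma linop_ext (f g : linop) : (forall u i, f u i = g u i) -> f = g.
Proof.
by move=> fg; apply: val_inj; apply/funext=> u; apply/funext=> i; apply: fg.
Qed.

HB.instance Definition _ (f : linop) :=
  GRing.isLinear.Build k V V _ f (linopP f).

Fact linop_one_linear : linear (idfun : V -> V). Proof. by []. Qed.
Fact linop_comp_linear (f g : linop) : linear (f \o g).
Proof. by move=> c u v; rewrite /= !linearP. Qed.

Definition linop_one := mk_linop linop_one_linear.
Definition linop_comp f g := mk_linop (linop_comp_linear f g).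

Fact linop_compA : associative linop_comp.
Proof. by move=> f g h; apply: linop_ext. Qed.
Fact linop_comp1l : left_id linop_one linop_comp.
Proof. by move=> f; apply: linop_ext. Qed.
Fact linop_comp1r : right_id linop_one linop_comp.
Proof. by move=> f; apply: linop_ext. Qed.
Fact linop_compDl : left_distributive linop_comp +%R.
Proof. by move=> f g h; apply: linop_ext. Qed.
Fact linop_compDr : right_distributive linop_comp +%R.
Proof. by move=> f g h; apply: linop_ext => u i; rewrite /= linearD. Qed.
Fact linop_one_neq0 : linop_one != 0.
Proof.
apply/eqP=> /(congr1 (fun f : linop => f (fun=> 1) 0)) /=.
by apply/eqP; exact: oner_neq0.
Qed.

HB.instance Definition _ := GRing.Zmodule_isNzRing.Build linop
  linop_compA linop_comp1l linop_comp1r linop_compDl linop_compDr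
  linop_one_neq0.

Fact linop_scaleAl (c : k) (f g : linop) : c *: (f * g) = c *: f * g.
Proof. by apply: linop_ext. Qed.
HB.instance Definition _ :=
  GRing.Lmodule_isLalgebra.Build k linop linop_scaleAl.
Fact linop_scaleAr (c : k) (f g : linop) : c *: (f * g) = f * (c *: g).
Proof. by apply: linop_ext => u i; rewrite /= linearZ. Qed.
HB.instance Definition _ :=
  GRing.Lalgebra_isAlgebra.Build k linop linop_scaleAr.

End LinearOperators.

HB.instance Definition _ (k : fieldType) (A : algType k) (s : algAut A) :=
  GRing.isLinear.Build k A A _ (aut_inv s)
    (can2_linear (aut_funK s) (aut_invK s)).
HB.instance Definition _ (k : fieldType) (A : algType k) (s : algAut A) :=
  GRing.isMonoidMorphism.Build A A (aut_inv s)
    (can2_monoid_morphism (aut_funK s) (aut_invK s)).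

(* The basis element of degree i: x^i if i >= 0, and y^(-i) otherwise. *)
Definition gwa_word (R : nzRingType) (x y : R) (i : int) : R :=
  match i with Posz n => x ^+ n | Negz n => y ^+ n.+1 end.

(* c i r is the coefficient of r in degree i; the last clause says that the
   words span R over D, as an induction principle. *)
Definition gwa_basis (k : fieldType) (D : comAlgType k) (R : algType k)
    (iota : {lrmorphism D -> R}) (x y : R) (c : int -> R -> D) : Prop :=
  [/\ forall i, linear (c i),
      forall i j d, c i (iota d * gwa_word x y j) = if i == j then d else 0 &
      forall P : R -> Prop, P 0 -> (forall r s, P r -> P s -> P (r + s)) ->
        (forall d i, P (iota d * gwa_word x y i)) -> forall r, P r].

(** * Left multiplication of words by the generators *)

Section Words.
Variables (k : fieldType) (D : comAlgType k) (sigma : algAut D) (a : D).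
Variables (S : algType k) (f : {lrmorphism D -> S}) (u v : S).
Hypothesis S_rel : gwa_rel sigma a f u v.

(** For [i >= 0] the word just grows; for [i < 0] the new [x] meets a [y], and [x y = sigma a]
    shortens the word. *)
Lemma gwa_mulx d i : u * (f d * gwa_word u v i) =
  f (sigma d * (if 0 <= i then 1 else sigma a)) * gwa_word u v (i + 1).
Proof.
have [ud vd vu uv] := S_rel.
rewrite mulrA ud -mulrA rmorphM -mulrA; congr (_ * _).
case: i => [n|[|n]].
- have -> : Posz n + 1 = Posz n.+1 by lia.
  by rewrite rmorph1 mul1r /= -exprS.
- by rewrite /= expr1 uv mulr1.
- have -> : Negz n.+1 + 1 = Negz n by lia.
  by rewrite /= exprS mulrA uv.
Qed.

Lemma gwa_muly d i : v * (f d * gwa_word u v i) =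
  f (aut_inv sigma d * (if i <= 0 then 1 else a)) * gwa_word u v (i - 1).
Proof.
have [ud vd vu uv] := S_rel.
rewrite mulrA vd -mulrA rmorphM -mulrA; congr (_ * _).
case: i => [[|n]|n].
- by rewrite /= rmorph1 mul1r mulr1 expr1.
- have -> : Posz n.+1 - 1 = Posz n by lia.
  by rewrite /= exprS mulrA vu.
- have -> : Negz n - 1 = Negz n.+1 by lia.
  by rewrite rmorph1 mul1r /= -exprS.
Qed.

End Words.

(** * The left regular action on coefficient families *)

Section RegularRepresentation.
Variables (k : fieldType) (D : comAlgType k) (sigma : algAut D) (a : D).
Local Notation V := (int -> D).

(* Left multiplications by d, x and y on the sum of the w i * gwa_word x y i. *)
Let opD_fun (d : D) : V -> V := fun w i => d * w i.
Let opX_fun : V -> V :=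
  fun w i => (if i <= 0 then sigma a else 1) * sigma (w (i - 1)).
Let opY_fun : V -> V :=
  fun w i => (if 0 <= i then a else 1) * aut_inv sigma (w (i + 1)).

Fact opD_linear d : linear (opD_fun d).
Proof.
by move=> c u v; apply/funext=> i; rewrite /opD_fun !fctE mulrDr scalerAr.
Qed.
Fact opX_linear : linear opX_fun.
Proof.
move=> c u v; apply/funext=> i.
by rewrite /opX_fun !fctE linearP mulrDr scalerAr.
Qed.
Fact opY_linear : linear opY_fun.
Proof.
move=> c u v; apply/funext=> i.
by rewrite /opY_fun !fctE linearP mulrDr scalerAr.
Qed.

Definition opD d : linop D := mk_linop (opD_linear d).
Definition opX : linop D := mk_linop opX_linear.
Definition opY : linop D := mk_linop opY_linear.

Fact opD_is_linear : linear opD.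
Proof.
move=> c d e; apply: linop_ext => w i.
change ((c *: d + e) * w i = c *: (d * w i) + e * w i).
by rewrite mulrDl scalerAl.
Qed.
Fact opD_is_monoid_morphism : monoid_morphism opD.
Proof.
split=> [|d e]; apply: linop_ext => w i; rewrite /= /opD_fun ?mul1r //.
by rewrite mulrA.
Qed.

HB.instance Definition _ :=
  GRing.isLinear.Build k D (linop D) _ opD opD_is_linear.
HB.instance Definition _ :=
  GRing.isMonoidMorphism.Build D (linop D) opD opD_is_monoid_morphism.

(** The tests in [opX_fun] and [opY_fun] look at the target degree. In either composite exactly one
    of the two steps contributes a nontrivial factor, so [a], respectively [sigma a], appears in
    every degree. *)
Lemma op_rel : gwa_rel sigma a opD opX opY.
Proof.
split=> [d|d||]; apply: linop_ext => w i;
  rewrite /= /opD_fun /opX_fun /opY_fun ?rmorphM /=.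
- by rewrite mulrCA.
- by rewrite mulrCA.
- rewrite aut_funK addrK mulrA; congr (_ * _).
  have -> : (i + 1 <= 0) = ~~ (0 <= i) by lia.
  by case: (0 <= i); rewrite /= ?rmorph1 ?aut_funK ?mulr1 ?mul1r.
- rewrite aut_invK subrK mulrA; congr (_ * _).
  have -> : (0 <= i - 1) = ~~ (i <= 0) by lia.
  by case: (i <= 0); rewrite /= ?rmorph1 ?mulr1 ?mul1r.
Qed.

End RegularRepresentation.

(** * From the universal property to the basis of words *)

Section BasisOfGWA.
Variables (k : fieldType) (D : comAlgType k) (sigma : algAut D) (a : D).
Variables (R : algType k) (iota : {lrmorphism D -> R}) (x y : R).
Hypothesis R_gwa : is_gwa sigma a iota x y.
Local Notation V := (int -> D).

Let e (i : int) : V := fun j => if j == i then 1 else 0.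

(** [e 0] is the family of the element 1, so acting on it by an element returns the coefficients of
    that element. *)
Lemma op_word i : gwa_word (opX sigma a) (opY sigma a) i (e 0) = e i.
Proof.
case: i; first elim=> [//|n IHn]; last elim=> [|n IHn].
- rewrite /= exprS /= in IHn *; rewrite IHn; apply/funext=> j; rewrite /e.
  have -> : (j - 1 == n) = (j == n.+1) by lia.
  by case: eqP => [->|]; rewrite ?rmorph0 ?mulr0 //= rmorph1 mulr1.
- apply/funext=> j; rewrite /=; rewrite /e.
  have -> : (j + 1 == 0) = (j == Negz 0) by lia.
  by case: eqP => [->|]; rewrite ?rmorph0 ?mulr0 //= rmorph1 mulr1.
- rewrite [gwa_word _ _ _]exprS.
  change (opY sigma a (gwa_word (opX sigma a) (opY sigma a) (Negz n) (e 0))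
    = e (Negz n.+1)).
  rewrite IHn; apply/funext=> j; rewrite /= /e.
  have -> : (j + 1 == Negz n) = (j == Negz n.+1) by lia.
  by case: eqP => [->|]; rewrite ?rmorph0 ?mulr0 //= rmorph1 mulr1.
Qed.

(** The span is not visibly closed under products, but the elements whose left multiplication
    preserves it form a subalgebra, to which [gwa_ind] applies; then evaluate at 1. *)
Lemma gwa_span (P : R -> Prop) : P 0 -> (forall r s, P r -> P s -> P (r + s)) ->
  (forall d i, P (iota d * gwa_word x y i)) -> forall r, P r.
Proof.
move=> P0 PA PW; have [_ R_rel _] := R_gwa.
(* Q r: left multiplication by r preserves the span of the words. *)
pose Q r := forall T : R -> Prop, T 0 ->
  (forall r s, T r -> T s -> T (r + s)) ->
  (forall d i, T (iota d * gwa_word x y i)) ->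
  forall d i, T (r * (iota d * gwa_word x y i)).
suff QR r : Q r.
  by move=> r; have := QR r P P0 PA PW 1 0;
    rewrite rmorph1 mul1r /= expr0 mulr1.
move: r; apply: (gwa_ind (P := Q)) R_gwa _ _ _.
- by move=> T T0 TA TW d i; rewrite mul1r.
- move=> c u v Hu Hv T T0 TA TW d i; rewrite mulrDl.
  apply: (TA); last exact: Hv T T0 TA TW d i.
  (* [T] need not be closed under scaling, so the scalar is absorbed into the coefficient [d]. *)
  by rewrite -scalerAl scalerAr scalerAl -linearZ; exact: Hu T T0 TA TW _ i.
- move=> u v Hu Hv T T0 TA TW d i; rewrite -mulrA.
  (* This shifted predicate is the reason why [Q] quantifies over all [T]. *)
  apply: (Hv (fun w => T (u * w))) => [|r s|]; rewrite ?mulr0 ?mulrDr //.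
    exact: TA.
  exact: Hu T T0 TA TW.
- by move=> d T T0 TA TW d' i; rewrite mulrA -rmorphM; apply: TW.
- by move=> T T0 TA TW d i; rewrite (gwa_mulx R_rel); apply: TW.
- by move=> T T0 TA TW d i; rewrite (gwa_muly R_rel); apply: TW.
Qed.

Lemma is_gwa_basis : exists c, gwa_basis iota x y c.
Proof.
have [_ _ univ] := R_gwa.
have [[g [gD gx gy]] _] := univ _ _ _ _ (op_rel sigma a).
exists (fun i r => g r (e 0) i); split; last exact: gwa_span.
- by move=> i c r s; rewrite linearP.
- move=> i j d; rewrite rmorphM /= gD.
  have -> : g (gwa_word x y j) = gwa_word (opX sigma a) (opY sigma a) j.
    by case: j => n /=; rewrite rmorphXn /= ?gx ?gy.
  change (d * gwa_word (opX sigma a) (opY sigma a) j (e 0) i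
    = if i == j then d else 0).
  by rewrite op_word /e; case: eqP; rewrite ?mulr1 ?mulr0.
Qed.

End BasisOfGWA.

(** * From a basis of words to the universal property *)

Section GWAOfBasis.
Variables (k : fieldType) (D : comAlgType k) (sigma : algAut D) (a : D).
Variables (R : algType k) (iota : {lrmorphism D -> R}) (x y : R).
Variable c : int -> R -> D.
Hypotheses (a_neq0 : a != 0) (R_rel : gwa_rel sigma a iota x y).
Hypothesis c_basis : gwa_basis iota x y c.

Section Extension.
Variables (S : algType k) (f : {lrmorphism D -> S}) (u v : S).
Hypothesis S_rel : gwa_rel sigma a f u v.

(** As [Negz n] is [-(n+1)], the degrees left over are those from [-N] to [N-1]. *)
Let supp (r : R) (N : nat) :=
  forall n, (N <= n)%N -> c (Posz n) r = 0 /\ c (Negz n) r = 0.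

Let supp_exists r : exists N, supp r N.
Proof.
have [cL cW span] := c_basis; move: r; apply: span.
- exists 0%N => n _.
  by split; rewrite -(subrr 0) -scaleN1r addrC cL scaleN1r addNr.
- move=> r s [N HN] [M HM]; exists (maxn N M) => n.
  rewrite geq_max => /andP[Nn Mn].
  have [rN rM] := HN n Nn; have [sN sM] := HM n Mn.
  by rewrite -(scale1r r) !cL rN rM sN sM !scaler0 addr0.
- move=> d i; exists (`|i|%N.+1) => n ltin; rewrite !cW.
  by split; case: eqP => // E; move: ltin; rewrite -E; lia.
Qed.

Let trunc (N : nat) (r : R) : S :=
  \sum_(n < N) (f (c (Posz n) r) * u ^+ n + f (c (Negz n) r) * v ^+ n.+1).

Let trunc_supp r N M : supp r N -> supp r M -> trunc N r = trunc M r.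
Proof.
wlog le_NM : N M / (N <= M)%N.
  move=> H HN HM; case: (leqP N M) => [|/ltnW] le; first exact: H.
  by rewrite (H M N).
move=> HN _; rewrite -(subnKC le_NM); elim: (M - N)%N => [|j IHj].
  by rewrite addn0.
have [z1 z2] := HN (N + j)%N (leq_addr _ _).
by rewrite addnS {2}/trunc big_ord_recr /= z1 z2 !rmorph0 !mul0r !addr0.
Qed.

(** The chosen bound is immaterial by [trunc_supp], so [extE] computes with any convenient one. *)
Let ext (r : R) : S := trunc (sval (cid (supp_exists r))) r.

Let extE r N : supp r N -> ext r = trunc N r.
Proof. by apply: trunc_supp; case: cid. Qed.

Fact ext_is_linear : linear ext.
Proof.
have [cL _ _] := c_basis; move=> b r s.
have [N HN] := supp_exists r; have [M HM] := supp_exists s.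
have HrL : supp r (maxn N M).
  by move=> n; rewrite geq_max => /andP[Nn _]; apply: HN.
have HsL : supp s (maxn N M).
  by move=> n; rewrite geq_max => /andP[_ Mn]; apply: HM.
have HL : supp (b *: r + s) (maxn N M).
  move=> n ln; have [r1 r2] := HrL n ln; have [s1 s2] := HsL n ln.
  by rewrite !cL r1 r2 s1 s2 !scaler0 !addr0.
rewrite (extE HL) (extE HrL) (extE HsL) /trunc scaler_sumr -big_split /=.
apply: eq_bigr => n _; rewrite !cL !linearP !mulrDl scalerDr -!scalerAl.
by rewrite addrACA.
Qed.

HB.instance Definition _ := GRing.isLinear.Build k R S _ ext ext_is_linear.

Let ext_word d i : ext (iota d * gwa_word x y i) = f d * gwa_word u v i.
Proof.
have [_ cW _] := c_basis.
have H : supp (iota d * gwa_word x y i) `|i|%N.+1.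
  move=> n ltin; rewrite !cW.
  by split; case: eqP => // E; move: ltin; rewrite -E; lia.
rewrite (extE H) /trunc; set j := `|i|%N.
(* The summand containing degree [i]; its other half, and all other summands, have coefficient 0. *)
have lt_ij : (match i with Posz n => n | Negz n => n end < j.+1)%N.
  by rewrite /j; case: i {H j} => n; lia.
rewrite (bigD1 (Ordinal lt_ij)) //= big1 => [|n ne]; rewrite !cW.
  by case: i {H} @j lt_ij => n j lt_ij;
    rewrite eqxx /= rmorph0 mul0r ?addr0 ?add0r.
have -> : (Posz n == i) = false.
  apply/negbTE; apply: contra ne => /eqP E.
  by apply/eqP/val_inj; rewrite /= -E.
have -> : (Negz n == i) = false.
  apply/negbTE; apply: contra ne => /eqP E.
  by apply/eqP/val_inj; rewrite /= -E.
by rewrite rmorph0 !mul0r addr0.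
Qed.

Let ext_mulD d s : ext (iota d * s) = f d * ext s.
Proof.
have [_ _ span] := c_basis; move: s; apply: span.
- by rewrite !(mulr0, linear0).
- by move=> r s IHr IHs; rewrite mulrDr !linearD /= mulrDr IHr IHs.
- by move=> e i; rewrite mulrA -rmorphM !ext_word rmorphM mulrA.
Qed.

(** On words, [gwa_mulx] gives the same coefficients in [R] and in [S]. *)
Let ext_mulx s : ext (x * s) = u * ext s.
Proof.
have [_ _ span] := c_basis; move: s; apply: span.
- by rewrite !(mulr0, linear0).
- by move=> r s IHr IHs; rewrite mulrDr !linearD /= mulrDr IHr IHs.
- by move=> d i; rewrite (gwa_mulx R_rel) !ext_word (gwa_mulx S_rel).
Qed.

Let ext_muly s : ext (y * s) = v * ext s.
Proof.
have [_ _ span] := c_basis; move: s; apply: span.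
- by rewrite !(mulr0, linear0).
- by move=> r s IHr IHs; rewrite mulrDr !linearD /= mulrDr IHr IHs.
- by move=> d i; rewrite (gwa_muly R_rel) !ext_word (gwa_muly S_rel).
Qed.

Let ext_D d : ext (iota d) = f d.
Proof. by have := ext_word d 0; rewrite /= !expr0 !mulr1. Qed.

(** The left factor may be taken to be [iota d] times a word, whose letters are peeled off one at a
    time by [ext_mulD], [ext_mulx] and [ext_muly]. *)
Fact ext_is_monoid_morphism : monoid_morphism ext.
Proof.
have [_ _ span] := c_basis.
split=> [|r s]; first by rewrite -(rmorph1 iota) ext_D rmorph1.
move: r; apply: span.
- by rewrite !(mul0r, linear0).
- by move=> r t IHr IHt; rewrite mulrDl !linearD /= mulrDl IHr IHt.
- move=> d i; rewrite ext_word -!mulrA ext_mulD; congr (_ * _).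
  case: i => n /=.
    by elim: n => [|n IHn]; rewrite ?mul1r // !exprS -!mulrA ext_mulx IHn.
  by elim: (n.+1) => [|j IHj]; rewrite ?mul1r // !exprS -!mulrA ext_muly IHj.
Qed.

HB.instance Definition _ :=
  GRing.isMonoidMorphism.Build R S ext ext_is_monoid_morphism.

Lemma gwa_ext : exists g : {lrmorphism R -> S},
  [/\ forall d, g (iota d) = f d, g x = u, g y = v &
      forall r, exists N, g r = \sum_(n < N)
        (f (c (Posz n) r) * u ^+ n + f (c (Negz n) r) * v ^+ n.+1)].
Proof.
exists ext; split; first exact: ext_D.
- by have := ext_mulx 1; rewrite !mulr1 rmorph1 mulr1.
- by have := ext_muly 1; rewrite !mulr1 rmorph1 mulr1.
- by move=> r; exists (sval (cid (supp_exists r))).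
Qed.

End Extension.

Lemma basis_is_gwa : is_gwa sigma a iota x y.
Proof.
split=> // S f u v S_rel; split.
  by have [g [gD gx gy _]] := gwa_ext S_rel; exists g.
move=> g h [gD gx gy] [hD hx hy]; have [_ _ span] := c_basis.
apply: span => [|r s IHr IHs|d i]; first by rewrite !rmorph0.
  by rewrite !rmorphD /= IHr IHs.
rewrite !rmorphM /= gD hD.
by case: i => n; rewrite /= !rmorphXn /= ?gx ?hx ?gy ?hy.
Qed.

(** For [S = R] the extension is the identity by uniqueness, and its explicit formula becomes the
    expansion of [r]. *)
Lemma basis_expand r : exists N, r = \sum_(n < N)
  (iota (c (Posz n) r) * x ^+ n + iota (c (Negz n) r) * y ^+ n.+1).
Proof.
have [g [gD gx gy gE]] := gwa_ext R_rel; have [N rE] := gE r; exists N.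
have [_ _ univ] := basis_is_gwa; rewrite -rE.
by have [_ uniq_gwa] := univ _ _ _ _ R_rel; apply: (uniq_gwa idfun g).
Qed.

End GWAOfBasis.

(** * Powers of automorphisms and their restriction to the fixed base *)

Section AutPower.
Variables (k : fieldType) (A : algType k) (s : algAut A) (m : nat).

Definition aut_pow_fun : A -> A := iter m s.

Fact aut_pow_is_linear : linear aut_pow_fun.
Proof.
rewrite /aut_pow_fun => c u v; elim: m => //= j ->.
exact: linearP.
Qed.

Fact aut_pow_is_monoid_morphism : monoid_morphism aut_pow_fun.
Proof.
rewrite /aut_pow_fun; split=> [|u v]; elim: m => //= j ->.
  exact: rmorph1.
exact: rmorphM.
Qed.

HB.instance Definition _ :=
  GRing.isLinear.Build k A A _ aut_pow_fun aut_pow_is_linear.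
HB.instance Definition _ :=
  GRing.isMonoidMorphism.Build A A aut_pow_fun aut_pow_is_monoid_morphism.

Fact aut_pow_funK : cancel aut_pow_fun (iter m (aut_inv s)).
Proof.
rewrite /aut_pow_fun; elim: m => //= j IHj u.
by rewrite iterSr /= aut_funK IHj.
Qed.

Fact aut_pow_invK : cancel (iter m (aut_inv s)) aut_pow_fun.
Proof.
rewrite /aut_pow_fun; elim: m => //= j IHj u.
by rewrite iterSr /= aut_invK IHj.
Qed.

Definition aut_pow : algAut A := AlgAut aut_pow_funK aut_pow_invK.

End AutPower.

Section AutRestriction.
Variables (k : fieldType) (D : comAlgType k) (R : algType k).
Variables (iota : {lrmorphism D -> R}) (phi : algAut R) (s : algAut D).
Local Notation fixD := (fixed_base_pred iota phi).
Hypotheses (sP : forall d, d \in fixD -> s d \in fixD)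
  (sVP : forall d, d \in fixD -> aut_inv s d \in fixD).
Local Notation B := (fixed_base iota phi).

Definition aut_res_fun (d : B) : B := FixedBase (sP (valP d)).
Definition aut_res_inv (d : B) : B := FixedBase (sVP (valP d)).

Fact aut_res_is_linear : linear aut_res_fun.
Proof. by move=> c u v; apply: val_inj; rewrite /= linearP. Qed.

Fact aut_res_is_monoid_morphism : monoid_morphism aut_res_fun.
Proof. by split=> [|u v]; apply: val_inj; rewrite /= ?rmorph1 ?rmorphM. Qed.

HB.instance Definition _ :=
  GRing.isLinear.Build k B B _ aut_res_fun aut_res_is_linear.
HB.instance Definition _ :=
  GRing.isMonoidMorphism.Build B B aut_res_fun aut_res_is_monoid_morphism.

Fact aut_res_funK : cancel aut_res_fun aut_res_inv.
Proof. by move=> d; apply: val_inj; rewrite /= aut_funK. Qed.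

Fact aut_res_invK : cancel aut_res_inv aut_res_fun.
Proof. by move=> d; apply: val_inj; rewrite /= aut_invK. Qed.

Definition aut_res : algAut B := AlgAut aut_res_funK aut_res_invK.

End AutRestriction.

(** * Relations between powers of the generators *)

Section Powers.
Variables (k : fieldType) (D : comAlgType k) (sigma : algAut D) (a : D).
Variables (S : algType k) (f : {lrmorphism D -> S}) (u v : S).
Hypothesis S_rel : gwa_rel sigma a f u v.

Lemma gwa_expx m d : u ^+ m * f d = f (iter m sigma d) * u ^+ m.
Proof.
have [ud _ _ _] := S_rel.
elim: m => [|m IHm]; first by rewrite mul1r mulr1.
by rewrite exprS -mulrA IHm mulrA ud -mulrA -exprS.
Qed.

Lemma gwa_expy m d : v ^+ m * f d = f (iter m (aut_inv sigma) d) * v ^+ m.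
Proof.
have [_ vd _ _] := S_rel.
elim: m => [|m IHm]; first by rewrite mul1r mulr1.
by rewrite exprS -mulrA IHm mulrA vd -mulrA -exprS.
Qed.

(** The innermost pair [v u] collapses to [a], and moving [f a] left past [v ^+ m] turns it into the
    last factor of the next product. *)
Lemma gwa_expyx m :
  v ^+ m * u ^+ m = f (\prod_(i < m) iter i (aut_inv sigma) a).
Proof.
have [_ _ vu _] := S_rel.
elim: m => [|m IHm]; first by rewrite big_ord0 rmorph1 mulr1.
rewrite exprSr exprS mulrA -(mulrA _ v) vu gwa_expy -mulrA IHm -rmorphM.
by rewrite big_ord_recr mulrC.
Qed.

Lemma gwa_expxy m :
  u ^+ m * v ^+ m = f (iter m sigma (\prod_(i < m) iter i (aut_inv sigma) a)).
Proof.
have [_ _ _ uv] := S_rel.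
elim: m => [|m IHm]; first by rewrite big_ord0 rmorph1 mulr1.
rewrite exprSr exprS mulrA -(mulrA _ u) uv gwa_expx -mulrA IHm -rmorphM.
have sM p q : iter m.+1 sigma (p * q) = iter m.+1 sigma p * iter m.+1 sigma q.
  exact: (rmorphM (aut_pow_fun sigma m.+1)).
(* The collapsed inner pair supplies the factor of index 0; in every other factor one [sigma]
   cancels one inverse. *)
rewrite -iterSr big_ord_recl sM; congr (f (_ * _)).
rewrite iterSr rmorph_prod; congr (iter m).
by apply: eq_bigr => i _; rewrite lift0 /= aut_invK.
Qed.

Lemma gwa_pow_rel m :
  gwa_rel (aut_pow sigma m) (\prod_(i < m) iter i (aut_inv sigma) a) f
    (u ^+ m) (v ^+ m).
Proof.
by split; [exact: gwa_expx|exact: gwa_expy|exact: gwa_expyx|exact: gwa_expxy].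
Qed.

Lemma gwa_word_exp m i : (0 < m)%N ->
  gwa_word (u ^+ m) (v ^+ m) i = gwa_word u v (i * m%:Z).
Proof.
case: m => // m _; case: i => n; first by rewrite /= -exprM mulnC.
have -> : Negz n * m.+1%:Z = Negz (m.+1 * n.+1).-1 by rewrite !NegzE; nia.
by rewrite /= -exprM.
Qed.

End Powers.

(** * Coefficients of fixed elements *)

Section FixedCoefficients.
Variables (k : fieldType) (D : comAlgType k) (sigma : algAut D) (a : D).
Variables (R : algType k) (iota : {lrmorphism D -> R}) (x y : R).
Hypothesis R_rel : gwa_rel sigma a iota x y.
Variables (c : int -> R -> D).
Hypothesis c_basis : gwa_basis iota x y c.
Variables (mu : k) (m : nat) (mu_order : m.-primitive_root mu).
Variables (phi : algAut R) (phiD : algAut D).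
Hypothesis phi_restr : forall d, phi (iota d) = iota (phiD d).
Hypotheses (phi_x : phi x = mu^-1 *: x) (phi_y : phi y = mu *: y).

Lemma basis_inj d e i :
  iota d * gwa_word x y i = iota e * gwa_word x y i -> d = e.
Proof.
have [_ cW _] := c_basis.
by move=> /(congr1 (c i)); rewrite !cW eqxx.
Qed.

Lemma coef_lin i : linear (c i). Proof. by have [] := c_basis. Qed.
HB.instance Definition _ i := GRing.isLinear.Build k R D _ (c i) (coef_lin i).

Lemma iota_inj : injective iota.
Proof. by move=> d e E; apply: (@basis_inj d e 0); rewrite E. Qed.

Lemma mu_neq0 : mu != 0.
Proof.
apply/eqP=> mu0; have := prim_expr_order mu_order.
rewrite mu0 expr0n (gtn_eqF (prim_order_gt0 mu_order)) => /eqP.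
by rewrite eq_sym oner_eq0.
Qed.

(** Apply [phi] to [x d = sigma(d) x], cancel [mu^-1] and compare coefficients in degree 1. *)
Lemma phiD_sigma d : phiD (sigma d) = sigma (phiD d).
Proof.
have [xd _ _ _] := R_rel; apply: (@basis_inj _ _ 1); rewrite /= expr1.
have /(congr1 phi) := xd d; rewrite !rmorphM /= !phi_restr phi_x.
rewrite -scalerAl xd -scalerAr.
by move/(scalerI (invr_neq0 mu_neq0)).
Qed.

Lemma phiD_sigmaV d : phiD (aut_inv sigma d) = aut_inv sigma (phiD d).
Proof.
by apply: (can_inj (aut_funK sigma)); rewrite -phiD_sigma !aut_invK.
Qed.

(** In [a = y x] the weights [mu] and [mu^-1] cancel. *)
Lemma phiD_a : phiD a = a.
Proof.
have [_ _ yx _] := R_rel; apply: iota_inj.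
rewrite -phi_restr -yx rmorphM /= phi_x phi_y -scalerAl -scalerAr scalerA.
by rewrite mulfV ?mu_neq0 // scale1r.
Qed.

Lemma fixed_baseP d : reflect (phiD d = d) (d \in fixed_base_pred iota phi).
Proof.
apply: (iffP eqP) => [E|E]; last by rewrite phi_restr E.
by apply: iota_inj; rewrite -phi_restr.
Qed.

Lemma phi_word i : phi (gwa_word x y i) = mu ^ (- i) *: gwa_word x y i.
Proof.
case: i => n /=; rewrite rmorphXn /= ?phi_x ?phi_y exprZn //.
by rewrite -exprnN exprVn.
Qed.

Lemma coef_phi i r : c i (phi r) = mu ^ (- i) *: phiD (c i r).
Proof.
have [_ cW span] := c_basis; move: r; apply: span.
- by rewrite !linear0.
- by move=> r s IHr IHs; rewrite !linearD /= IHr IHs.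
- move=> d j; rewrite rmorphM /= phi_restr phi_word -scalerAr linearZ /= !cW.
  by case: eqP => [->|_]; rewrite ?rmorph0 ?scaler0.
Qed.

Lemma coef_fixed_eigen i r : phi r = r -> phiD (c i r) = mu ^ i *: c i r.
Proof.
move=> Hr; rewrite -{2}Hr coef_phi scalerA -expfzDr ?mu_neq0 // subrr expr0z.
by rewrite scale1r.
Qed.

Lemma mu_expz_eq1 i : (mu ^ i == 1) = (m %| `|i|)%N.
Proof.
case: i => n; first by rewrite /= (prim_order_dvd mu_order).
by rewrite NegzE -exprnN invr_eq1 abszN /= (prim_order_dvd mu_order).
Qed.

Lemma coef_fixed_eq0 n i r : coprime m n -> iter n phiD =1 id -> phi r = r ->
  ~~ (m %| `|i|)%N -> c i r = 0.
Proof.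
move=> mn phin Hr; apply: contraNeq => cN0.
have iterE j : iter j phiD (c i r) = (mu ^ i) ^+ j *: c i r.
  elim: j => [|j IHj]; first by rewrite scale1r.
  by rewrite /= IHj linearZ /= (coef_fixed_eigen i Hr) scalerA -exprSr.
have: ((mu ^ i) ^+ n - 1) *: c i r = 0.
  by rewrite scalerBl -iterE phin scale1r subrr.
(* A nonzero vector of [D] killed by a scalar forces [mu ^ (i n) = 1], so [m] divides [i n], and by
   coprimality it divides [i]. *)
move/eqP; rewrite scaler_eq0 (negbTE cN0) orbF subr_eq0 exprnP exprz_exp.
by rewrite mu_expz_eq1 abszM Gauss_dvdl.
Qed.

Lemma coef_fixed_in i r : phi r = r -> (m %| `|i|)%N ->
  c i r \in fixed_base_pred iota phi.
Proof.
move=> Hr; rewrite -mu_expz_eq1 => /eqP mui; apply/fixed_baseP.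
by rewrite coef_fixed_eigen // mui scale1r.
Qed.

End FixedCoefficients.

(** * The basis of the fixed ring over the fixed base *)

Theorem theorem3p3 (k : fieldType) (D : comAlgType k)
    (D_domain : GRing.integral_domain_axiom D)
    (sigma : algAut D) (a : D)
    (R : algType k) (iota : {lrmorphism D -> R}) (x y : R)
    (R_gwa : is_gwa sigma a iota x y)
    (mu : k) (m : nat) (mu_order : m.-primitive_root mu)
    (phi : algAut R)
    (phiD : algAut D) (phi_restr : forall d, phi (iota d) = iota (phiD d))
    (n : nat) (phiD_order : has_order phiD n)
    (phi_x : phi x = mu^-1 *: x) (phi_y : phi y = mu *: y)
    (mn_coprime : coprime m n) :
  exists (tau : algAut (fixed_base iota phi)) (A : fixed_base iota phi)
         (X Y : fixed_ring phi),
    [/\ forall d, fixed_base_val (tau d) = iter m sigma (fixed_base_val d),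
        fixed_base_val A = \prod_(i < m) iter i (aut_inv sigma) a,
        fixed_val X = x ^+ m,
        fixed_val Y = y ^+ m &
        is_gwa tau A (fixed_incl iota phi) X Y].
Proof.
have [c c_basis] := is_gwa_basis R_gwa; have [a_neq0 R_rel _] := R_gwa.
have [cL cW _] := c_basis; have [_ phin _] := phiD_order.
have fixP d := fixed_baseP c_basis phi_restr d.
have iter_sigma j d : phiD (iter j sigma d) = iter j sigma (phiD d).
  elim: j => //= j <-.
  exact: (phiD_sigma R_rel c_basis mu_order phi_restr phi_x).
have iter_sigmaV j d : phiD (iter j (aut_inv sigma) d) =
    iter j (aut_inv sigma) (phiD d).
  elim: j => //= j <-.
  exact: (phiD_sigmaV R_rel c_basis mu_order phi_restr phi_x).
have phia := phiD_a R_rel c_basis mu_order phi_restr phi_x phi_y.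
have sP d : d \in fixed_base_pred iota phi ->
    aut_pow sigma m d \in fixed_base_pred iota phi.
  by move=> /fixP Hd; apply/fixP; rewrite /= /aut_pow_fun iter_sigma Hd.
have sVP d : d \in fixed_base_pred iota phi ->
    aut_inv (aut_pow sigma m) d \in fixed_base_pred iota phi.
  by move=> /fixP Hd; apply/fixP; rewrite /= iter_sigmaV Hd.
pose a' := \prod_(i < m) iter i (aut_inv sigma) a.
have AP : a' \in fixed_base_pred iota phi.
  apply/fixP; rewrite rmorph_prod; apply: eq_bigr => i _.
  by rewrite /= iter_sigmaV phia.
have mum := prim_expr_order mu_order.
have XP : x ^+ m \in fixed_pred phi.
  by apply/eqP; rewrite rmorphXn /= phi_x exprZn exprVn mum invr1 scale1r.
have YP : y ^+ m \in fixed_pred phi.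
  by apply/eqP; rewrite rmorphXn /= phi_y exprZn mum scale1r.
pose tau := aut_res sP sVP; pose A := FixedBase AP.
pose X := FixedRing XP; pose Y := FixedRing YP.
exists tau, A, X, Y; split=> //.
(* The domain hypothesis enters here: each factor is the image of [a] under an injective map, and a
   product of nonzero factors is nonzero. *)
have a'_neq0 : a' != 0.
  rewrite /a'; elim/big_ind: _ => [|u v u0 v0|i _]; first exact: oner_neq0.
    by apply/negP => /eqP /D_domain; rewrite (negbTE u0) (negbTE v0).
  elim: (nat_of_ord i) => //= j; apply: contraNneq => E.
  by rewrite -(aut_invK sigma (iter j _ a)) E rmorph0.
have m_gt0 := prim_order_gt0 mu_order.
have valX (r : fixed_ring phi) j : val (r ^+ j) = val r ^+ j.
  by elim: j => [|j IHj] //; rewrite !exprS -IHj.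
have valW j : val (gwa_word X Y j) = gwa_word x y (j * m%:Z).
  by rewrite -gwa_word_exp //; case: j => j; rewrite [LHS]valX.
have m_dvd (j : int) : (m %| `|(j * m%:Z)%R|)%N by rewrite abszM dvdn_mull.
have valP' (r : fixed_ring phi) : phi (val r) = val r.
  by apply/eqP; exact: (valP r).
(* Degree [j] in [X] and [Y] is degree [j m] in [x] and [y], where coefficients of fixed elements
   lie in the fixed base. *)
pose c' (j : int) (r : fixed_ring phi) : fixed_base iota phi :=
  FixedBase (coef_fixed_in c_basis mu_order phi_restr phi_x phi_y
    (valP' r) (m_dvd j)).
apply: (@basis_is_gwa _ _ _ _ _ _ _ _ c').
- by apply: contra a'_neq0 => /eqP /(congr1 val) /= ->.
- have [Xd Yd YX XY] := gwa_pow_rel R_rel m.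
  by split=> [d|d||]; apply: val_inj => /=; rewrite ?Xd ?Yd ?YX ?XY.
split.
- by move=> j b r s; apply: val_inj => /=; rewrite cL.
- move=> i j d; apply: val_inj => /=; rewrite valW cW.
  have -> : (i * m%:Z == j * m%:Z) = (i == j) by nia.
  by case: eqP.
move=> P P0 PA PW r.
(* [P] only speaks of the fixed ring, so each component of [r] must be lifted there: to a word in
   [X] and [Y] if [m] divides [i], and to 0 otherwise because the coefficient vanishes. *)
have step i : exists2 t : fixed_ring phi,
    val t = iota (c i (val r)) * gwa_word x y i & P t.
  case: (boolP (m %| `|i|)%N) => [/dvdnP [q iE]|ndvd].
    have [j ->] : exists j, i = j * m%:Z.
      by case: (i) iE => i' iE; [exists q%:Z|exists (- q%:Z)]; nia.
    exists (fixed_incl iota phi (c' j r) * gwa_word X Y j); last exact: PW.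
    by rewrite /= valW.
  exists 0 => //=.
  rewrite (coef_fixed_eq0 c_basis mu_order phi_restr phi_x phi_y mn_coprime
    phin (valP' r) ndvd).
  by rewrite rmorph0 mul0r.
have [N rE] := basis_expand a_neq0 R_rel c_basis (val r).
suff [t tE Pt] : exists2 t : fixed_ring phi, val t = val r & P t.
  by rewrite -(val_inj tE).
(* Every partial sum of the expansion lifts, so the induction runs on the number of summands, with
   [r] still supplying the coefficients. *)
rewrite rE; elim: N {rE} => [|N [t tE Pt]].
  by exists 0 => //; rewrite big_ord0.
have [t1 E1 P1] := step (Posz N); have [t2 E2 P2] := step (Negz N).
exists (t + (t1 + t2)); last by do 2! apply: (PA) => //.
by rewrite big_ord_recr /= -tE -E1 -E2.
Qed.
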